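(* Let $\mathscr{H}$ be a complex Hilbert space and $S\in\mathbb{B}(\mathscr{H})$. Let $\mathscr{H}_0\neq\{0\}$ be a closed subspace of $\mathscr{H}$ and let $P$ be the orthogonal projection onto $\mathscr{H}_0$. Then the following statements hold: (i) If $\dim\mathscr{H}<\infty$, then $P\perp_B S$ if and only if there is a unit vector $\xi\in\mathscr{H}_0$ such that $[S\xi,\xi]=0$. (ii) If $\dim\mathscr{H}=\infty$, then $P\perp_B S$ if and only if there is a sequence of unit vectors $(\xi_n)\subset\mathscr{H}_0$ such that $\lim_{n\to\infty}[S\xi_n,\xi_n]=0$.
   Context: $\mathbb{B}(\mathscr{H})$ is the algebra of bounded linear operators on $\mathscr{H}$ with the operator norm, and $[\cdot,\cdot]$ is the inner product of $\mathscr{H}$. Birkhoff--James orthogonality: for $T,S\in\mathbb{B}(\mathscr{H})$, $T\perp_B S$ means $\|T+\lambda S\|\ge\|T\|$ for all $\lambda\in\mathbb{C}$. *)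

(* Defs.v *)
From HB Require Import structures.
From mathcomp Require Import all_boot all_order all_algebra.
From mathcomp Require Import complex.
From mathcomp Require Import all_classical all_reals all_analysis.

Set Implicit Arguments.
Unset Strict Implicit.
Unset Printing Implicit Defensive.

Import Order.TTheory GRing.Theory Num.Theory.
Import numFieldNormedType.Exports.

Local Open Scope classical_set_scope.
Local Open Scope complex_scope.
Local Open Scope ring_scope.

(* The inner product is linear in its first argument and conjugate-linear in
   its second one. *)
HB.mixin Record isHilbert (R : realType) H of CompleteNormedModule R[i] H := {
  inner : {dot H for Num.conj} ;
  sqr_normr : forall x : H, `|x| ^+ 2 = inner x x }.

#[short(type="hilbertType")]
HB.structure Definition Hilbert (R : realType) :=
  {H of CompleteNormedModule R[i] H & isHilbert R H}.

Definition finite_dim (K : fieldType) (V : lmodType K) : Prop :=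
  exists n, inhabited (Vector.axiom n V).

Section BoundedOperators.
Context {K : numFieldType} {V : normedModType K}.

Definition bounded_linear : {pred V -> V} := mem
  [set f | linear f /\ exists M : K, forall x, `|f x| <= M * `|x|].

Lemma bounded_linear_submod_closed : submod_closed bounded_linear.
Proof.
split=> [|a f g /set_mem[linf [M fM]] /set_mem[ling [N gN]]]; apply/mem_set.
  split=> [c x y|]; first by rewrite /= scaler0 addr0.
  by exists 0 => x; rewrite mul0r normr0.
split=> [c x y|].
  rewrite ![(a *: f + g) _]/(a *: f _ + g _) linf ling !scalerDr !scalerA.
  by rewrite (mulrC a c) addrACA.
exists (`|a| * M + N) => x; rewrite mulrDl -mulrA.
apply: le_trans (ler_normD _ _) (lerD _ (gN x)).
by rewrite normrZ ler_wpM2l.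
Qed.

HB.instance Definition _ :=
  GRing.isSubmodClosed.Build K (V -> V) bounded_linear
    bounded_linear_submod_closed.

End BoundedOperators.

Record bounded_op (K : numFieldType) (V : normedModType K) := BoundedOp {
  bounded_op_fun :> V -> V ;
  bounded_op_prop : bounded_op_fun \in bounded_linear }.

Notation "''B' ( V )" := (@bounded_op _ V)
  (at level 8, format "''B' ( V )") : type_scope.

Section BoundedOpTheory.
Context {K : numFieldType} {V : normedModType K}.

HB.instance Definition _ := [isSub for @bounded_op_fun K V].
HB.instance Definition _ := [Choice of 'B(V) by <:].
HB.instance Definition _ := [SubChoice_isSubLmodule of 'B(V) by <:].

Implicit Types (T S : 'B(V)).

Lemma bounded_op_addE T S x : (T + S) x = T x + S x. Proof. by []. Qed.

Lemma bounded_op_scaleE (a : K) T x : (a *: T) x = a *: T x. Proof. by []. Qed.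

Lemma bounded_op_linear T : linear T.
Proof. by have /set_mem[] := bounded_op_prop T. Qed.

Lemma bounded_op_bounded T : exists M : K, forall x, `|T x| <= M * `|x|.
Proof. by have /set_mem[] := bounded_op_prop T. Qed.

HB.instance Definition _ T :=
  GRing.isLinear.Build K V V *:%R T (bounded_op_linear T).

End BoundedOpTheory.

Section OperatorNorm.
Context {R : realType} {V : normedModType R[i]}.
Implicit Types (T S : 'B(V)).

(* The norm of [V] takes its values in R[i], where they are nonnegative
   reals; [Re] reads them in [R]. *)
Definition opnorm T : R :=
  sup [set complex.Re `|T x| | x in [set x : V | `|x| <= 1]].

Lemma opnorm_has_sup T :
  has_sup [set complex.Re `|T x| | x in [set x : V | `|x| <= 1]].
Proof.
split; first by exists (complex.Re `|T 0|), 0 => //=; rewrite normr0 ler01.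
have [M TM] := bounded_op_bounded T; exists (complex.Re `|M|) => _ [x x1 <-].
have : `|T x| <= `|M|.
  rewrite -[leLHS]normr_id; apply: (@le_trans _ _ `|M * `|x| |).
    by rewrite !ger0_norm ?TM// (le_trans _ (TM x)).
  by rewrite normrM normr_id ler_piMr.
by rewrite lecE => /andP[].
Qed.

Definition bj_orthogonal T S : Prop :=
  forall lambda : R[i], opnorm T <= opnorm (T + lambda *: S).

End OperatorNorm.

Notation "T '_|_B' S" := (bj_orthogonal T S)
  (at level 70, no associativity, format "T  '_|_B'  S") : type_scope.

Definition orthogonal_projection (R : realType) (H : hilbertType R)
    (H0 : set H) (P : H -> H) : Prop :=
  forall x, H0 (P x) /\ forall y, H0 y -> inner (x - P x) y = 0.

(* Main.v *)
From HB Require Import structures.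
Require Import Defs.
From mathcomp Require Import all_boot all_order all_algebra.
From mathcomp Require Import complex.
From mathcomp Require Import ring lra.
From mathcomp Require Import all_classical all_reals all_analysis.
Import Order.TTheory GRing.Theory Num.Theory numFieldNormedType.Exports.
Local Open Scope classical_set_scope.
Local Open Scope complex_scope.
Local Open Scope ring_scope.

(** Both parts follow from one equivalence ([bj_orthogonal_numrange]): with H0
    nonzero, P _|_B S holds if and only if 0 is in the closure of the set
      W = { <S x, x> : x a unit vector of H0 },
    that is, W meets every open disc centred at 0.

    If W comes arbitrarily close to 0, then the norm of P + l S is at least
    Re <(P + l S) x, x> = 1 + Re (l <S x, x>) for every unit x in H0, hence at
    least 1 = norm of P.

    Conversely suppose that W keeps at distance at least e > 0 from 0.  W is
    convex, being the numerical range of the compression of S to H0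
    (Toeplitz-Hausdorff, [numrange_convex]), so it lies in a half-plane
    Re (w^* z) >= c > 0 ([numrange_halfplane]).  Thus T = w^* S is coercive on
    H0, and a small step P - h T has norm strictly less than 1
    ([opnorm_projection_sub_lt1]): writing x = u + v with u = P x, the gain
    2 h c |u|^2 is of first order in h, while the cross term 2 h |<T v, u>| is
    absorbed by |v|^2 up to an error of second order.

    In infinite dimension the equivalence is restated with a sequence.  In
    finite dimension the unit ball of H is compact
    ([finite_dim_compact_ball]), so W is the continuous image of a compact set,
    hence closed, and 0 is attained ([finite_dim_attained]). *)

(** * Real-valued norm and inner product *)

Section RealInnerProduct.
Context {R : realType} {H : hilbertType R}.
Implicit Types (x y z : H) (a b : R[i]) (r : R).

(** The norm of [H] read in [R], the norm of [H] itself being valued in [R[i]].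
    The modulus of a scalar [a] is likewise read as [complex.Re `|a|]. *)
Definition rnorm x : R := complex.Re `|x|.

(** The real inner product underlying [inner]; it induces the same norm. *)
Definition rdot x y : R := complex.Re (inner x y).

Lemma normE x : `|x| = (rnorm x)%:C.
Proof. by rewrite /rnorm RRe_real// ger0_real. Qed.

Lemma rnorm_ge0 x : 0 <= rnorm x.
Proof. by rewrite -ler0c -normE. Qed.

Lemma norm_eq1 x : `|x| = 1 <-> rnorm x = 1.
Proof. by rewrite normE; split=> [[]//|->]. Qed.

Lemma inner_self x : inner x x = (rnorm x ^+ 2)%:C.
Proof. by rewrite -sqr_normr normE rmorphXn. Qed.

Lemma rdot_self x : rdot x x = rnorm x ^+ 2.
Proof. by rewrite /rdot inner_self. Qed.

Lemma innerC x y : inner x y = (inner y x)^*.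
Proof. by rewrite hermC expr0 mul1r. Qed.

Lemma innerDl x y z : inner (x + y) z = inner x z + inner y z.
Proof. exact: linearDl. Qed.

Lemma innerDr x y z : inner x (y + z) = inner x y + inner x z.
Proof. exact: linearDr. Qed.

Lemma innerZl a x y : inner (a *: x) y = a * inner x y.
Proof. exact: linearZl_LR. Qed.

Lemma innerZr a x y : inner x (a *: y) = a^* * inner x y.
Proof. by rewrite linearZr_LR. Qed.

Lemma innerNl x y : inner (- x) y = - inner x y.
Proof. exact: linearNl. Qed.

Lemma innerNr x y : inner x (- y) = - inner x y.
Proof. exact: linearNr. Qed.

Lemma ReD a b : complex.Re (a + b) = complex.Re a + complex.Re b.
Proof. by case: a b => [? ?] [? ?]. Qed.

Lemma ReZ r a : complex.Re (r%:C * a) = r * complex.Re a.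
Proof. by case: a => b c; simpc. Qed.

Lemma rdotC x y : rdot x y = rdot y x.
Proof. by rewrite /rdot innerC; case: (inner y x). Qed.

Lemma rdotDl x y z : rdot (x + y) z = rdot x z + rdot y z.
Proof. by rewrite /rdot innerDl ReD. Qed.

Lemma rdotDr x y z : rdot z (x + y) = rdot z x + rdot z y.
Proof. by rewrite rdotC rdotDl !(rdotC z). Qed.

Lemma rdotZl r x y : rdot (r%:C *: x) y = r * rdot x y.
Proof. by rewrite /rdot innerZl ReZ. Qed.

Lemma rdotZr r x y : rdot x (r%:C *: y) = r * rdot x y.
Proof. by rewrite rdotC rdotZl rdotC. Qed.

Lemma normc_realE a : `|a| = (complex.Re `|a|)%:C.
Proof. by rewrite RRe_real// ger0_real. Qed.

Lemma rnormZ a x : rnorm (a *: x) = complex.Re `|a| * rnorm x.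
Proof. by apply: complexI; rewrite rmorphM /= -!normE normrZ -normc_realE. Qed.

Lemma rnorm_normalize x : 0 < rnorm x -> rnorm ((rnorm x)^-1%:C *: x) = 1.
Proof.
move=> x0; rewrite rnormZ normc_def /= expr0n addr0 sqrtr_sqr.
by rewrite ger0_norm ?invr_ge0 ?ltW// mulVf ?gt_eqF.
Qed.

Lemma sqr_rnormD x y :
  rnorm (x + y) ^+ 2 = rnorm x ^+ 2 + 2 * rdot x y + rnorm y ^+ 2.
Proof. by rewrite -!rdot_self !(rdotDl, rdotDr) (rdotC y x); ring. Qed.

Lemma rnormD x y : rnorm (x + y) <= rnorm x + rnorm y.
Proof. by rewrite -lecR rmorphD /= -!normE ler_normD. Qed.

(** The real Cauchy-Schwarz inequality, read off the triangle inequality. *)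
Lemma rdot_le x y : rdot x y <= rnorm x * rnorm y.
Proof.
have : rnorm (x + y) ^+ 2 <= (rnorm x + rnorm y) ^+ 2.
  by rewrite lerXn2r ?nnegrE ?addr_ge0 ?rnorm_ge0// rnormD.
by rewrite sqr_rnormD; nra.
Qed.

(** The complex Cauchy-Schwarz inequality. *)
Lemma norm_inner_le x y : `|inner x y| <= `|x| * `|y|.
Proof.
set w := inner x y; have [->|w0] := eqVneq w 0.
  by rewrite normr0 mulr_ge0.
(* Rotating y by w makes the inner product real, equal to |w|^2. *)
have : rdot x (w *: y) <= rnorm x * rnorm (w *: y) := rdot_le _ _.
rewrite /rdot innerZr -/w mulrC -sqr_normc rnormZ.
have w1 : 0 < complex.Re `|w| by rewrite -ltcR -normc_realE normr_gt0.
rewrite normc_realE -rmorphXn /= expr2 mulrCA ler_pM2l// => le.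
by rewrite !normE -rmorphM /= lecR.
Qed.

Lemma sqr_normc_Re_Im a :
  complex.Re `|a| ^+ 2 = complex.Re a ^+ 2 + complex.Im a ^+ 2.
Proof. by apply: complexI; rewrite rmorphXn /= -normc_realE add_Re2_Im2. Qed.

Lemma Re_normM a b :
  complex.Re `|a * b| = complex.Re `|a| * complex.Re `|b|.
Proof. by apply: complexI; rewrite rmorphM /= -!normc_realE normrM. Qed.

Lemma Re_le_norm a : `|complex.Re a| <= complex.Re `|a|.
Proof. by rewrite -lecR -normc_realE normc_ge_Re. Qed.

Lemma sqr_normcD a b s :
  complex.Re `|a + s%:C * b| ^+ 2
  = complex.Re `|a| ^+ 2 + 2 * s * complex.Re (a^* * b)
    + s ^+ 2 * complex.Re `|b| ^+ 2.
Proof.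
by rewrite !sqr_normc_Re_Im; case: a b => [? ?] [? ?]; simpc => /=; ring.
Qed.

End RealInnerProduct.

(** * Convexity of the numerical range *)

Section NumericalRange.
Context {R : realType} {H : hilbertType R}.
Implicit Types (x y z : H) (a b w : R[i]) (r s t : R).

Lemma conj_real r : (r%:C : R[i])^* = r%:C.
Proof. exact: conjc_real. Qed.

Lemma exists_phase w : exists u : R[i], `|u| = 1 /\ complex.Im (u * w) = 0.
Proof.
have [->|w0] := eqVneq w 0; first by exists 1; rewrite normr1 mulr0.
exists (`|w|^-1 * w^*); split.
  by rewrite normrM normfV normr_id normcJ mulVf// normr_eq0.
by rewrite -mulrA (mulrC _ w) -sqr_normc expr2 mulKf ?normr_eq0.
Qed.

(** The intermediate value theorem on [0, 1] for the quadratic that appears in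
    the Toeplitz-Hausdorff argument: the difference of the two sides is -t <= 0
    at s = 0 and 1 - t >= 0 at s = 1. *)
Lemma segment_root (g r t : R) : 0 <= t <= 1 ->
  exists s, 0 <= s <= 1 /\
    s ^+ 2 + s * (1 - s) * g
    = t * ((1 - s) ^+ 2 + s ^+ 2 + 2 * s * (1 - s) * r).
Proof.
move=> /andP[t0 t1].
pose p : {poly R} := 'X ^+ 2 + 'X * (1 - 'X) * g%:P
  - t%:P * ((1 - 'X) ^+ 2 + 'X ^+ 2 + 2%:P * 'X * (1 - 'X) * r%:P).
have pE s : p.[s] = s ^+ 2 + s * (1 - s) * g
    - t * ((1 - s) ^+ 2 + s ^+ 2 + 2 * s * (1 - s) * r).
  by rewrite /p !hornerE.
have [|s s01] := @Num.poly_ivt _ p 0 1 ler01.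
  by rewrite !pE; apply/andP; split; lra.
by rewrite /root pE subr_eq0 => /eqP ps; exists s.
Qed.

(** The right-hand side is u times a quantity independent of u, so a suitable
    phase u makes both imaginary parts vanish. *)
Lemma Im_phase (d u f g : R[i]) :
  complex.Im (d^* * (u^* * f + u * g)) = complex.Im (u * (d^* * g - d * f^* )).
Proof.
case: d u f g => [d1 d2] [u1 u2] [f1 f2] [g1 g2]; simpc => /=.
by ring.
Qed.

(** The Toeplitz-Hausdorff theorem: the values of the quadratic form of T on
    unit vectors form a convex set.  The point at parameter t of the segment
    between the values at x and y is attained on the span of x and y. *)
Lemma numrange_convex (T : {linear H -> H}) x y t :
  rnorm x = 1 -> rnorm y = 1 -> 0 <= t <= 1 ->
  exists a b, rnorm (a *: x + b *: y) = 1 /\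
    inner (T (a *: x + b *: y)) (a *: x + b *: y)
    = inner (T x) x + t%:C * (inner (T y) y - inner (T x) x).
Proof.
move=> x1 y1 t01; set e := inner (T x) x; set d := inner (T y) y - e.
have [d0|d0] := eqVneq d 0.
  by exists 1, 0; rewrite scale1r scale0r addr0 d0 mulr0 addr0.
(* The sesquilinear form of T - e: F x x = 0 and F y y = d. *)
pose F u v := inner (T u) v - e * inner u v.
have FD u v u' v' : F (u + v) (u' + v') = F u u' + F u v' + F v u' + F v v'.
  by rewrite /F linearD !(innerDl, innerDr); ring.
have FZ a b u v : F (a *: u) (b *: v) = a * b^* * F u v.
  by rewrite /F linearZZ !(innerZl, innerZr); ring.
have Fx : F x x = 0 by rewrite /F inner_self x1 expr1n mulr1 subrr.
have Fy : F y y = d by rewrite /F inner_self y1 expr1n mulr1.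
(* Replacing y by u y for a suitable phase u turns the sum q of the two cross
   terms of F into a real multiple g of d. *)
have [u [u1 uI]] := exists_phase (d^* * F y x - d * (F x y)^*).
have uu : u * u^* = 1 by rewrite -sqr_normc u1 expr1n.
pose q := u^* * F x y + u * F y x.
pose g := complex.Re (d^* * q) / complex.Re (d^* * d).
have dd : d^* * d = (complex.Re (d^* * d))%:C.
  by rewrite mulrC -sqr_normc normc_realE -rmorphXn.
have dd0 : d^* * d != 0 by rewrite mulf_neq0// conjc_eq0.
have qE : q = d * g%:C.
  have dq : d^* * q = (complex.Re (d^* * q))%:C.
    by rewrite [LHS]complexE /q Im_phase uI mulr0 addr0.
  apply: (mulfI (_ : d^* != 0)); first by rewrite conjc_eq0.
  rewrite mulrA dd dq -rmorphM /=; congr (_%:C); rewrite /g [RHS]mulrC divfK//.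
  by apply: contra_neq dd0; rewrite dd => ->.
(* F z z / d is now real for z on the segment from x to u y, and its quotient by
   |z|^2 takes every value t between 0 and 1. *)
have [s [s01 sE]] := segment_root g (rdot x (u *: y)) t t01.
pose z := (1 - s)%:C *: x + s%:C *: (u *: y).
have uy1 : rnorm (u *: y) = 1 by rewrite rnormZ u1 mul1r.
have zE : rnorm z ^+ 2
    = (1 - s) ^+ 2 + s ^+ 2 + 2 * s * (1 - s) * rdot x (u *: y).
  rewrite -rdot_self /z !(rdotDl, rdotDr, rdotZl, rdotZr) !rdot_self x1 uy1.
  by rewrite (rdotC (u *: y)); ring.
have Fz : F z z = (t * rnorm z ^+ 2)%:C * d.
  rewrite zE -sE /z scalerA FD !FZ Fx Fy.
  have -> : (s%:C * u)^* = s%:C * u^*.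
    by rewrite -[in RHS](conj_real s); exact: rmorphM.
  rewrite !conj_real.
  transitivity ((1 - s)%:C * s%:C * q + s%:C ^+ 2 * (u * u^* ) * d).
    by rewrite /q; ring.
  by rewrite uu qE !(rmorphD, rmorphM, rmorphXn) /=; ring.
have z0 : 0 < rnorm z.
  (* If z = 0 then (1 - s) x and s u y are opposite vectors, on which F takes
     the values 0 and s^2 d; so s = 0 and z = x, which is a unit vector. *)
  rewrite lt_neqAle rnorm_ge0 andbT eq_sym; apply/eqP => zn0.
  have /eqP : z = 0 by apply/normr0_eq0; rewrite normE zn0.
  rewrite /z addr_eq0 scalerA -scaleNr => /eqP zE0.
  have : F ((1 - s)%:C *: x) ((1 - s)%:C *: x) = 0 by rewrite FZ Fx mulr0.
  rewrite zE0 FZ Fy => /eqP; rewrite mulf_eq0 (negPf d0) orbF -sqr_normc.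
  rewrite sqrf_eq0 normr_eq0 oppr_eq0 mulf_eq0 -normr_eq0 -(normr_eq0 u) u1.
  rewrite oner_eq0 orbF normr_eq0 => /eqP[s0].
  move: zn0; rewrite /z s0 subr0 scale1r scale0r addr0 x1 => /eqP.
  by rewrite oner_eq0.
exists ((rnorm z)^-1 * (1 - s))%:C, ((rnorm z)^-1%:C * (s%:C * u)).
have -> : ((rnorm z)^-1 * (1 - s))%:C *: x + ((rnorm z)^-1%:C * (s%:C * u)) *: y
    = (rnorm z)^-1%:C *: z.
  by rewrite /z scalerDr !scalerA rmorphM.
split; first exact: rnorm_normalize.
set v := _ *: z; have v1 : rnorm v = 1 by exact: rnorm_normalize.
have : F v v = t%:C * d.
  rewrite /v FZ Fz conj_real mulrA -!rmorphM /=; congr (_%:C * _).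
  by field; rewrite gt_eqF.
rewrite {1}/F inner_self v1 expr1n mulr1 => /eqP.
by rewrite subr_eq addrC => /eqP.
Qed.
End NumericalRange.

(** * Operator norm *)

Section OperatorNorm.
Context {R : realType} {H : hilbertType R}.
Implicit Types (x : H) (r : R) (T : 'B(H)).

Lemma bounded_op_rnorm (T : 'B(H)) :
  exists2 M, 0 <= M & forall x, rnorm (T x) <= M * rnorm x.
Proof.
have [M TM] := bounded_op_bounded T; exists (complex.Re `|M|) => [|x].
  by rewrite -ler0c -normc_realE.
rewrite -lecR rmorphM /= -normc_realE -!normE.
rewrite -[leLHS]normr_id -[X in _ * X]normr_id -normrM.
by rewrite !ger0_norm ?TM// (le_trans _ (TM x)).
Qed.

Lemma opnorm_ge (T : 'B(H)) x : rnorm x <= 1 -> rnorm (T x) <= opnorm T.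
Proof.
move=> x1; apply: sup_upper_bound; first exact: opnorm_has_sup.
by exists x => //=; rewrite normE lecR.
Qed.

Lemma opnorm_le (T : 'B(H)) r :
  (forall x, rnorm x <= 1 -> rnorm (T x) <= r) -> opnorm T <= r.
Proof.
move=> Tr; apply: ge_sup; first by case: (opnorm_has_sup T).
by move=> _ [x /= x1 <-]; apply: Tr; rewrite -lecR -normE.
Qed.

End OperatorNorm.

(** * Subspaces and separation of the numerical range from 0 *)

Section Subspaces.
Context {R : realType} {H : hilbertType R} (H0 : set H).
Context (H0_subspace : submod_closed [in H0]).
Implicit Types (x y : H) (a : R[i]).

Lemma subspaceZ a x : H0 x -> H0 (a *: x).
Proof.
case: H0_subspace => H00 H0D H0x.
have : a *: x + 0 \in [in H0] by apply: H0D => //; exact/mem_set.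
by rewrite addr0 => /set_mem.
Qed.

Lemma subspaceD x y : H0 x -> H0 y -> H0 (x + y).
Proof.
case: H0_subspace => _ H0D H0x H0y; rewrite -[x]scale1r.
by apply/set_mem/(H0D 1); apply/mem_set.
Qed.

Lemma subspaceB x y : H0 x -> H0 y -> H0 (x - y).
Proof.
by move=> H0x H0y; rewrite -scaleN1r; apply: subspaceD => //; exact: subspaceZ.
Qed.

Lemma subspace_unit_vector :
  H0 <> [set 0] -> exists2 x, H0 x & rnorm x = 1.
Proof.
have H00 : H0 0 by case: H0_subspace => /set_mem.
move=> H0_neq0; have [x [H0x x0]] : exists x, H0 x /\ x != 0.
  apply: contrapT => nx; apply: H0_neq0; apply/seteqP; split=> [x H0x|_ ->//].
  by apply: contrapT => /eqP x0; apply: nx; exists x.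
have xn : 0 < rnorm x by rewrite -ltcR -normE normr_gt0.
by exists ((rnorm x)^-1%:C *: x); [exact: subspaceZ|exact: rnorm_normalize].
Qed.

(** If the values of the quadratic form of S on unit vectors of H0 stay away from
    0, they lie in an open half-plane not containing 0.  The normal w is the
    value at a vector x1 that nearly minimises the squared modulus, with infimum
    m > 0: by convexity the segment from w to any other value keeps squared
    modulus at least m, which bounds Re (w^* z) below. *)
Lemma numrange_halfplane (S : 'B(H)) (e : R) :
  (exists2 x, H0 x & rnorm x = 1) -> 0 < e ->
  (forall x, H0 x -> rnorm x = 1 -> e <= complex.Re `|inner (S x) x|) ->
  exists w c, 0 < c /\
   forall x, H0 x -> rnorm x = 1 -> c <= complex.Re (w^* * inner (S x) x).
Proof.
move=> [x0 H0x0 x01] e0 eS.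
have [M M0 SM] := bounded_op_rnorm S.
pose E := [set complex.Re `|inner (S x) x| ^+ 2 | x in
  [set x | H0 x /\ rnorm x = 1]].
have Elb : lbound E (e ^+ 2).
  move=> _ [x [H0x x1] <-]; have ex := eS x H0x x1.
  by rewrite lerXn2r// nnegrE ?(le_trans _ ex)// ltW.
have Einf : has_inf E.
  split; last by exists (e ^+ 2).
  by exists (complex.Re `|inner (S x0) x0| ^+ 2), x0.
pose m := inf E; pose D := (2 * M) ^+ 2.
have m0 : 0 < m.
  by rewrite (lt_le_trans (exprn_gt0 2 e0))// lb_le_inf//; case: Einf.
have D0 : 0 <= D by rewrite exprn_even_ge0.
have q_le x : rnorm x = 1 -> complex.Re `|inner (S x) x| <= M.
  move=> x1; have : `|inner (S x) x| <= `|S x| * `|x| := norm_inner_le _ _.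
  rewrite normc_realE !normE x1 -rmorphM /= lecR mulr1 => /le_trans; apply.
  by rewrite (le_trans (SM x))// x1 mulr1.
have qD x y : rnorm x = 1 -> rnorm y = 1 ->
    complex.Re `|inner (S y) y - inner (S x) x| ^+ 2 <= D.
  move=> x1 y1; rewrite lerXn2r ?nnegrE ?mulr_ge0//.
    by rewrite -ler0c -normc_realE.
  rewrite (@le_trans _ _
    (complex.Re `|inner (S y) y| + complex.Re `|inner (S x) x|))//.
    by rewrite -lecR rmorphD /= -!normc_realE ler_normB.
  by have := q_le _ x1; have := q_le _ y1; lra.
(* s is both the parameter of the point used on the segment and the square root
   of the tolerance in the choice of x1; s (1 + D) <= m leaves the margin m / 2. *)
pose s := m / (1 + D + m).
have s0 : 0 < s by rewrite divr_gt0//; lra.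
have sE : s * (1 + D + m) = m by rewrite /s divfK// gt_eqF//; lra.
have s1 : s <= 1 by nra.
have [_ [x1 [H0x1 x11] <-]] := inf_adherent (exprn_gt0 2 s0) Einf.
rewrite -/m => x1m.
have mx1 : m <= complex.Re `|inner (S x1) x1| ^+ 2.
  by apply: ge_inf; [case: Einf | exists x1].
exists (inner (S x1) x1), (m / 2); split=> [|x H0x xn1].
  by rewrite divr_gt0.
have [|a [b [zn1 zq]]] := numrange_convex S x1 x s x11 xn1.
  by rewrite ltW.
have : m <= complex.Re `|inner (S (a *: x1 + b *: x)) (a *: x1 + b *: x)| ^+ 2.
  apply: ge_inf; first by case: Einf.
  exists (a *: x1 + b *: x) => //; split=> //.
  by apply: subspaceD; exact: subspaceZ.
rewrite zq sqr_normcD.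
have := qD _ _ x11 xn1.
have -> : complex.Re ((inner (S x1) x1)^* * (inner (S x) x - inner (S x1) x1))
   = complex.Re ((inner (S x1) x1)^* * inner (S x) x)
     - complex.Re `|inner (S x1) x1| ^+ 2.
  rewrite sqr_normc_Re_Im.
  case: (inner (S x1) x1) (inner (S x) x) => [? ?] [? ?].
  by simpc => /=; ring.
move: x1m mx1.
set A := complex.Re _ ^+ 2; set B := complex.Re (_ * _).
set N := complex.Re _ ^+ 2 => Am mA ND mle.
have sN : s ^+ 2 * N <= s ^+ 2 * D by rewrite ler_wpM2l ?sqr_ge0.
have : 0 <= s * (s * (1 + D) + 2 * (B - A)) by nra.
by rewrite pmulr_rge0//; nra.
Qed.


End Subspaces.

(** * Birkhoff-James orthogonality to a projection *)

Section Projection.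
Context {R : realType} {H : hilbertType R} (H0 : set H) (P : 'B(H)).
Context (H0_subspace : submod_closed [in H0])
  (P_proj : orthogonal_projection H0 P).
Implicit Types (x : H) (S T : 'B(H)) (c e h : R) (l : R[i]).

Lemma projection_pythagoras x :
  rnorm x ^+ 2 = rnorm (P x) ^+ 2 + rnorm (x - P x) ^+ 2.
Proof.
have [H0Px Pxo] := P_proj x.
rewrite -[in LHS](subrK (P x) x) (sqr_rnormD (x - P x)).
by rewrite /rdot Pxo//= mulr0 addr0 addrC.
Qed.

Lemma projection_id x : H0 x -> P x = x.
Proof.
have [H0Px Pxo] := P_proj x => H0x; apply/esym/eqP.
rewrite -subr_eq0 -normr_eq0 -sqrf_eq0 sqr_normr Pxo//; exact: (subspaceB H0).
Qed.

(** A small step against an operator that is coercive on H0 decreases the norm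
    of P strictly below 1. *)
Lemma opnorm_projection_sub_lt1 T c :
  0 < c -> (forall x, H0 x -> rnorm x = 1 -> c <= rdot (T x) x) ->
  exists2 h, 0 < h & opnorm (P + (- h)%:C *: T) < 1.
Proof.
move=> c0 Tc; have [M M0 TM] := bounded_op_rnorm T.
(* Coercivity extends to all of H0 by homogeneity. *)
have Tcu u : H0 u -> c * rnorm u ^+ 2 <= rdot (T u) u.
  move=> H0u; have [u0|u0] := eqVneq (rnorm u) 0.
    rewrite u0 expr0n mulr0.
    have -> : u = 0 by apply/normr0_eq0; rewrite normE u0.
    by rewrite /rdot linear0r.
  have un : 0 < rnorm u by rewrite lt_neqAle eq_sym u0 rnorm_ge0.
  set k := rnorm u in un *; set v := k^-1%:C *: u.
  have v1 : rnorm v = 1 by exact: rnorm_normalize.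
  have uE : u = k%:C *: v.
    by rewrite /v scalerA -rmorphM /= divff ?gt_eqF// scale1r.
  have TuE : T u = k%:C *: T v by rewrite {1}uE linearZZ.
  rewrite TuE {1}uE rdotZl rdotZr mulrA -expr2 mulrC ler_wpM2l ?sqr_ge0//.
  by apply: Tc => //; exact: (subspaceZ H0).
(* The step h is chosen so that 3 h M^2 <= c and h c <= 1/4; the norm of
   P - h T is then at most the square root of 1 - h c. *)
pose h := c / (3 * M ^+ 2 + 4 * c ^+ 2 + 1).
have M20 := sqr_ge0 M; have c20 := sqr_ge0 c.
have h0 : 0 < h by rewrite divr_gt0//; lra.
have hE : h * (3 * M ^+ 2 + 4 * c ^+ 2 + 1) = c.
  by rewrite divfK// gt_eqF//; lra.
have hM : 3 * h * M ^+ 2 <= c by nra.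
have hc : h * c <= 1 / 4 by nra.
exists h => //.
apply: (@le_lt_trans _ _ (Num.sqrt (1 - h * c))); last first.
  by rewrite -[ltRHS]sqrtr1 ltr_sqrt//; nra.
apply: opnorm_le => x x1.
rewrite -(ger0_norm (rnorm_ge0 _)) -sqrtr_sqr ler_sqrt; last lra.
rewrite bounded_op_addE bounded_op_scaleE.
rewrite sqr_rnormD rdotZr rnormZ exprMn sqr_normc_Re_Im /= expr0n addr0 sqrrN.
have [H0Px _] := P_proj x; set u := P x in H0Px *; set v := x - u.
have -> : rdot u (T x)
    = rdot (T u) u + rdot (T v) u.
  by rewrite rdotC -rdotDl -linearD /v addrCA subrr addr0.
have Tv : - (M * rnorm v * rnorm u) <= rdot (T v) u.
  have := rdot_le (- T v) u.
  have -> : rdot (- T v) u = - rdot (T v) u.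
    by apply/eqP; rewrite -subr_eq0 opprK -rdotDl addNr /rdot linear0l.
  have -> : rnorm (- T v) = rnorm (T v).
    by rewrite /rnorm normrN.
  by have := TM v; have := rnorm_ge0 u; nra.
have Tx : rnorm (T x) ^+ 2 <= M ^+ 2.
  rewrite lerXn2r ?nnegrE ?rnorm_ge0// (le_trans (TM x))//.
  by rewrite ler_piMr.
have := Tcu _ H0Px; have pyt := projection_pythagoras x.
rewrite -/u -/v in pyt.
have x2 : rnorm x ^+ 2 <= 1 by rewrite expr_le1// rnorm_ge0.
move: pyt x2 Tv Tx (rnorm_ge0 u) (rnorm_ge0 v).
set A := rnorm u; set B := rnorm v.
set p := rdot (_ u) u; set q := rdot (_ v) u.
set T2 := rnorm (T x) ^+ 2; set X2 := rnorm x ^+ 2 => XE X1 qB T2M A0 B0 pA.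
have B2 := sqr_ge0 B; have A1 : A <= 1 by nra.
have hq : - (h * q) <= h * (M * B).
  have MBA : M * B * A <= M * B by rewrite ler_piMr// mulr_ge0.
  by rewrite -mulrN ler_wpM2l ?(ltW h0)//; lra.
have hp : h * c * A ^+ 2 <= h * p by rewrite -mulrA ler_wpM2l ?(ltW h0).
have hhM : h ^+ 2 * M ^+ 2 <= h * (c / 3).
  by rewrite expr2 -mulrA ler_wpM2l ?(ltW h0)//; lra.
have hT : h ^+ 2 * T2 <= h ^+ 2 * M ^+ 2.
  by rewrite ler_wpM2l ?sqr_ge0.
(* The cross term is absorbed by the component of x orthogonal to H0. *)
have BM : 2 * (h * (M * B)) <= B ^+ 2 / 2 + 2 * h ^+ 2 * M ^+ 2.
  by have := sqr_ge0 (B - 2 * h * M); lra.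
have hcX : (1 - 2 * (h * c)) * (A ^+ 2 + B ^+ 2) <= (1 - 2 * (h * c)).
  by rewrite ler_piMr -?XE//; lra.
by nra.
Qed.

(** P _|_B S if and only if the numerical range of S on H0 comes arbitrarily
    close to 0. *)
Lemma bj_orthogonal_numrange S : (exists2 x, H0 x & rnorm x = 1) ->
  P _|_B S <-> forall e, 0 < e ->
    exists x, [/\ H0 x, rnorm x = 1 & complex.Re `|inner (S x) x| < e].
Proof.
move=> [x0 H0x0 x01]; split=> [PS e e0|Se l]; last first.
  apply: (@le_trans _ _ 1).
    apply: opnorm_le => x x1.
    rewrite -(@ler_pXn2r _ 2)// ?nnegrE ?rnorm_ge0// expr1n.
    have := projection_pythagoras x; have := sqr_ge0 (rnorm (x - P x)).
    by have := rnorm_ge0 x; nra.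
  apply/ler_addgt0Pr => e e0.
  have l0 : 0 <= complex.Re `|l| by rewrite -ler0c -normc_realE.
  have [|x [H0x x1 xe]] := Se (e / (1 + complex.Re `|l|)).
    by rewrite divr_gt0//; lra.
  have le_op : rnorm ((P + l *: S) x) <= opnorm (P + l *: S).
    by apply: opnorm_ge; rewrite x1.
  have := rdot_le ((P + l *: S) x) x.
  rewrite x1 mulr1 bounded_op_addE bounded_op_scaleE (projection_id _ H0x).
  rewrite rdotDl rdot_self x1 expr1n /rdot innerZl => le1.
  have := Re_le_norm (l * inner (S x) x).
  rewrite Re_normM ler_norml => /andP[le2 _].
  have : complex.Re `|l| * complex.Re `|inner (S x) x| <= e.
    move: xe; rewrite ltr_pdivlMr; last lra.
    have q0 : 0 <= complex.Re `|inner (S x) x| by rewrite -ler0c -normc_realE.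
    by nra.
  move: le_op le1 le2.
  rewrite bounded_op_addE bounded_op_scaleE (projection_id _ H0x).
  by lra.
apply: contrapT => nS.
have eS x : H0 x -> rnorm x = 1 -> e <= complex.Re `|inner (S x) x|.
  by move=> H0x x1; rewrite leNgt; apply/negP => xe; apply: nS; exists x.
have [w [c [c0 wc]]] := numrange_halfplane H0 H0_subspace S e
  (ex_intro2 _ _ x0 H0x0 x01) e0 eS.
have [|h h0 Ph] := opnorm_projection_sub_lt1 (w^* *: S) c c0.
  by move=> x H0x x1; rewrite bounded_op_scaleE /rdot innerZl; exact: wc.
have op1 : 1 <= opnorm P.
  by rewrite -x01 -[X in rnorm X](projection_id _ H0x0) opnorm_ge// x01.
have := PS ((- h)%:C * w^*); apply/negP; rewrite -ltNge (lt_le_trans _ op1)//.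
by rewrite -scalerA.
Qed.

End Projection.

(** * Compactness in finite dimension *)

Section FiniteDimension.
Context {R : realType} {H : hilbertType R}.
Implicit Types (x y z b p q : H) (s : seq H) (c : R[i]).

Lemma real_complex_continuous :
  continuous (fun r : R => r%:C : R[i]^o).
Proof.
move=> r; apply/cvgrPdist_lt => e e0.
have eE : e = (complex.Re e)%:C by rewrite RRe_real// gtr0_real.
have re0 : 0 < complex.Re e by rewrite -ltcR -eE.
near=> t.
rewrite -rmorphB /= normc_def /= expr0n addr0 sqrtr_sqr eE ltcR.
by near: t; apply: cvgr_dist_lt.
Unshelve. all: by end_near. Qed.

(** The closed unit disc of the complex plane is contained in a compact set. *)
Lemma compact_disc : exists2 D : set R[i]^o,
  compact D & forall c, complex.Re `|c| <= 1 -> D c.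
Proof.
pose f (z : R * R) : R[i]^o := (z.1)%:C + 'i%C * (z.2)%:C.
exists (f @` (`[-1, 1] `*` `[-1, 1])).
  apply: continuous_compact; last first.
    by apply: compact_setX; exact: segment_compact.
  apply: continuous_subspaceT => z.
  apply: cvgD.
    apply: (@continuous_comp _ _ _ fst (fun r : R => r%:C : R[i]^o)).
      exact: cvg_fst.
    exact: real_complex_continuous.
  apply: cvgM; first exact: cvg_cst.
  apply: (@continuous_comp _ _ _ snd (fun r : R => r%:C : R[i]^o)).
    exact: cvg_snd.
  exact: real_complex_continuous.
move=> c c1; exists (complex.Re c, complex.Im c); last first.
  by rewrite /f /= -complexE.
have c0 : 0 <= complex.Re `|c| by rewrite -ler0c -normc_realE.
have := sqr_normc_Re_Im c.
have := sqr_ge0 (complex.Re c); have := sqr_ge0 (complex.Im c) => i0 r0 cE.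
split; rewrite /= in_itv /= -ler_norml -(@ler_pXn2r _ 2)// ?nnegrE// expr1n.
  by rewrite real_normK ?num_real//; nra.
by rewrite real_normK ?num_real//; nra.
Qed.

(** The linear span of a list of vectors, by recursion on the list: x is in the
    span of b :: s when some x - c b is in the span of s. *)
Fixpoint lin_span s : set H :=
  if s is b :: s' then [set x | exists c, lin_span s' (x - c *: b)]
  else [set 0].

Lemma lin_spanDZ s c x y :
  lin_span s x -> lin_span s y -> lin_span s (x + c *: y).
Proof.
elim: s c x y => [|b s IHs] c x y /=.
  by move=> -> ->; rewrite scaler0 addr0.
move=> [d xd] [e ye]; exists (d + c * e).
have -> : x + c *: y - (d + c * e) *: b = (x - d *: b) + c *: (y - e *: b).
  by rewrite scalerBr scalerA scalerDl opprD addrACA.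
exact: IHs.
Qed.

Lemma lin_span_sum (I : Type) (r : seq I) (c : I -> R[i]) (b : I -> H) :
  lin_span [seq b i | i <- r] (\sum_(i <- r) c i *: b i).
Proof.
elim: r => [|i r IHr] /=; first by rewrite big_nil.
by exists (c i); rewrite big_cons addrC addKr.
Qed.

(** Orthogonal projection onto the span of a list, by the Gram-Schmidt step: q is
    the part of b orthogonal to the span of s. *)
Lemma lin_span_proj s y :
  exists2 p, lin_span s p & forall v, lin_span s v -> inner (y - p) v = 0.
Proof.
elim: s y => [|b s IHs] y.
  by exists 0 => // v ->; rewrite linear0r.
have [p sp pb] := IHs b; have [u su uy] := IHs y.
pose q := b - p; pose d := inner y q / inner q q.
have dq : d * inner q q = inner y q.
  have [q0|q0] := eqVneq (inner q q) 0; last by rewrite divfK.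
  rewrite q0 mulr0; have -> : q = 0.
    by apply/normr0_eq0/eqP; rewrite -sqrf_eq0 sqr_normr q0.
  by rewrite linear0r.
exists (u + d *: q).
  exists d; have -> : u + d *: q - d *: b = u + (- d) *: p.
    by rewrite /q scalerBr scaleNr addrA addrAC addrK.
  exact: lin_spanDZ.
move=> x [c sx]; pose v := x - c *: b + c *: p.
have sv : lin_span s v by exact: lin_spanDZ.
have -> : x = v + c *: q by rewrite /v /q scalerBr addrACA addrA subrK addrK.
have uq : inner u q = 0 by rewrite innerC pb// rmorph0.
have yuq : inner (y - u - d *: q) q = 0.
  by rewrite !(innerDl, innerNl) innerZl uq subr0 dq subrr.
have yuv : inner (y - u - d *: q) v = 0.
  by rewrite innerDl uy// innerNl innerZl pb// mulr0 subr0.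
by rewrite opprD addrA innerDr yuv innerZr yuq mulr0 addr0.
Qed.

(** By orthogonality, the unit ball of the span of b :: s lies in the sum of a
    compact set containing the unit ball of the span of s and of the unit disc
    of the line generated by the part q of b orthogonal to that span. *)
Lemma compact_lin_span_ball s :
  exists2 K : set H, compact K & forall x, lin_span s x -> rnorm x <= 1 -> K x.
Proof.
elim: s => [|b s [K Kc sK]].
  by exists [set 0]; [exact: compact_set1|move=> x].
have [D Dc D1] := compact_disc.
have [p sp pb] := lin_span_proj s b; pose q := b - p.
(* If q = 0 then e = 0 too, and [qE] still holds. *)
pose e := (rnorm q)^-1%:C *: q.
have qE : q = (rnorm q)%:C *: e.
  have [q0|q0] := eqVneq (rnorm q) 0.
    by rewrite /e q0 scale0r; apply/normr0_eq0; rewrite normE q0.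
  by rewrite /e scalerA -rmorphM /= divff// scale1r.
pose f (z : R[i]^o * H) : H := z.2 + z.1 *: e.
exists (f @` (D `*` K)).
  apply: continuous_compact; last exact: compact_setX.
  apply: continuous_subspaceT => z.
  apply: cvgD; first exact: cvg_snd.
  apply: cvgZ; [exact: cvg_fst|exact: cvg_cst].
move=> x [c sx] x1; pose v := x - c *: q.
have sv : lin_span s v.
  have -> : v = x - c *: b + c *: p.
    by rewrite /v /q scalerBr opprB addrA addrAC.
  exact: lin_spanDZ.
have xE : x = v + c *: q by rewrite /v subrK.
have pyt : rnorm x ^+ 2 = rnorm v ^+ 2 + rnorm (c *: q) ^+ 2.
  rewrite {1}xE sqr_rnormD rdotC /rdot innerZl (pb v sv) mulr0 /=.
  by rewrite mulr0 addr0.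
have x2 : rnorm x ^+ 2 <= 1 by rewrite expr_le1// rnorm_ge0.
exists (c * (rnorm q)%:C, v); last by rewrite /f /= -scalerA -qE -xE.
split => /=.
  apply: D1; have -> : complex.Re `|c * (rnorm q)%:C| = rnorm (c *: q).
    by rewrite rnormZ Re_normM -normE normr_id.
  rewrite -(@ler_pXn2r _ 2)// ?nnegrE ?rnorm_ge0// expr1n.
  by have := sqr_ge0 (rnorm v); lra.
apply: sK => //; rewrite -(@ler_pXn2r _ 2)// ?nnegrE ?rnorm_ge0// expr1n.
by have := sqr_ge0 (rnorm (c *: q)); lra.
Qed.

Lemma finite_dim_compact_ball : finite_dim H ->
  exists2 K : set H, compact K & forall x, rnorm x <= 1 -> K x.
Proof.
move=> [n [[f flin [g fK gK]]]].
have [K Kc sK] := compact_lin_span_ball [seq g (delta_mx 0 i) | i <- enum 'I_n].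
exists K => // x; apply: sK.
have -> : x = \sum_(i <- enum 'I_n) f x 0 i *: g (delta_mx 0 i).
  pose fL : {linear H -> 'rV[R[i]]_n} :=
    HB.pack f (GRing.isLinear.Build _ _ _ _ f flin).
  apply: (can_inj fK); rewrite -[f (\sum_(i <- _) _)]/(fL _) linear_sum.
  rewrite [LHS]row_sum_delta big_enum; apply: eq_bigr => i _.
  by rewrite linearZ /= gK.
exact: lin_span_sum.
Qed.

Lemma quadratic_form_continuous (S : 'B(H)) :
  continuous (fun x : H => inner (S x) x : R[i]^o).
Proof.
move=> x; apply/cvgrPdist_lt => e e0.
have eE : e = (complex.Re e)%:C by rewrite RRe_real// gtr0_real.
have re0 : 0 < complex.Re e by rewrite -ltcR -eE.
have [M M0 SM] := bounded_op_rnorm S.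
pose L := M * (2 * rnorm x + 1).
have x0 := rnorm_ge0 x.
have L0 : 0 <= L by rewrite mulr_ge0//; lra.
near=> t.
have xt1 : rnorm (x - t) < 1.
  by rewrite -ltcR -normE; near: t; apply: cvgr_dist_lt.
have xte : rnorm (x - t) < complex.Re e / (L + 1).
  rewrite -ltcR -normE; near: t; apply: cvgr_dist_lt => //.
  by rewrite ltcR divr_gt0//; lra.
have -> : inner (S x) x - inner (S t) t
    = inner (S (x - t)) x + inner (S t) (x - t).
  by rewrite linearB innerDl innerNl innerDr innerNr addrA subrK.
rewrite (le_lt_trans (ler_normD _ _))//.
rewrite (le_lt_trans (lerD (norm_inner_le _ _) (norm_inner_le _ _)))//.
rewrite !normE -!rmorphM -rmorphD eE ltcR.
have tx : rnorm t <= rnorm x + 1.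
  by have := rnormD (t - x) x; rewrite subrK /rnorm distrC -/(rnorm _); lra.
move: xte; rewrite ltr_pdivlMr; last lra.
apply: le_lt_trans.
have := SM (x - t); have := SM t.
have := rnorm_ge0 (x - t).
set a := rnorm (S t); set b := rnorm (S _); set d := rnorm _ => d0 at_ bd.
have : b * rnorm x <= M * d * rnorm x by rewrite ler_wpM2r.
have : a * d <= M * (rnorm x + 1) * d.
  by rewrite ler_wpM2r// (le_trans at_)// ler_wpM2l.
by rewrite /L; lra.
Unshelve. all: by end_near. Qed.

(** In finite dimension the numerical range of S on a closed H0 is closed, so it
    contains 0 as soon as it comes arbitrarily close to 0. *)
Lemma finite_dim_attained (S : 'B(H)) (H0 : set H) : finite_dim H ->
  closed H0 ->
  (forall e : R, 0 < e -> exists x,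
     [/\ H0 x, rnorm x = 1 & complex.Re `|inner (S x) x| < e]) ->
  exists x, [/\ H0 x, rnorm x = 1 & inner (S x) x = 0].
Proof.
move=> Hfin H0c appr.
have [K Kc K1] := finite_dim_compact_ball Hfin.
pose U := [set x : H | `|x| = 1].
have Uc : closed U.
  have -> : U = (fun x : H => `|x| : R[i]^o) @^-1` [set 1] by [].
  apply: preimage_closed; last first.
    exact/accessible_closed_set1/hausdorff_accessible/norm_hausdorff.
  by move=> x _; exact: norm_continuous.
pose W := (fun x : H => inner (S x) x : R[i]^o) @` (K `&` (H0 `&` U)).
have Wc : closed W.
  apply: compact_closed; first exact: norm_hausdorff.
  apply: continuous_compact.
    exact/continuous_subspaceT/quadratic_form_continuous.
  by apply: compact_closedI => //; exact: closedI.
have : W 0.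
  apply: Wc => A /nbhs_ballP[e /= e0 eA].
  have eE : e = (complex.Re e)%:C by rewrite RRe_real// gtr0_real.
  have [|x [H0x x1 xe]] := appr (complex.Re e); first by rewrite -ltcR -eE.
  exists (inner (S x) x); split; last first.
    by apply: eA; rewrite -ball_normE /= sub0r normrN normc_realE eE ltcR.
  exists x => //; split; first by apply: K1; rewrite x1.
  by split => //; apply/norm_eq1.
by move=> [x [_ [H0x /norm_eq1 x1]] q0]; exists x.
Qed.

End FiniteDimension.

Theorem theorem2p8 (R : realType) (H : hilbertType R) (S : 'B(H))
    (H0 : set H) (H0_subspace : submod_closed [in H0]) (H0_closed : closed H0)
    (H0_neq0 : H0 <> [set 0]) (P : 'B(H)) (P_proj : orthogonal_projection H0 P) :
  (finite_dim H ->
    (P _|_B S <-> exists xi : H, [/\ H0 xi, `|xi| = 1 & inner (S xi) xi = 0]))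
  /\
  (~ finite_dim H ->
    (P _|_B S <->
     exists xi : nat -> H, [/\ forall n, H0 (xi n), forall n, `|xi n| = 1 &
       (inner (S (xi n)) (xi n) : R[i]^o) @[n --> \oo] --> (0 : R[i]^o)])).
Proof.
have unitH0 : exists2 x, H0 x & rnorm x = 1 by exact: (subspace_unit_vector H0).
have bjE := bj_orthogonal_numrange H0 P H0_subspace P_proj S unitH0.
split=> [Hfin|_]; split.
- move=> /bjE /(finite_dim_attained S H0 Hfin H0_closed)[x [H0x x1 x0]].
  by exists x; split=> //; apply/norm_eq1.
- move=> [x [H0x /norm_eq1 x1 x0]]; apply/bjE => e e0.
  by exists x; split=> //; rewrite x0 normr0.
- move=> /bjE appr.
  have /choice[xi xiP] : forall n : nat, exists x, [/\ H0 x, rnorm x = 1 &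
      complex.Re `|inner (S x) x| < n.+1%:R^-1] by move=> n; apply: appr.
  exists xi; split=> [n|n|]; first by case: (xiP n).
    by apply/norm_eq1; case: (xiP n).
  apply/cvgrPdist_lt => e e0.
  have eE : e = (complex.Re e)%:C by rewrite RRe_real// gtr0_real.
  have re0 : 0 < complex.Re e by rewrite -ltcR -eE.
  near=> n; rewrite sub0r normrN normc_realE eE ltcR.
  have [_ _ /lt_trans->//] := xiP n.
  by near: n; exact: near_infty_natSinv_lt (PosNum re0).
- move=> [xi [H0xi xi1 /cvgrPdist_lt cvxi]]; apply/bjE => e e0.
  have [|n _ /(_ n (leqnn n))] := cvxi e%:C; first by rewrite ltcR.
  rewrite /= sub0r normrN normc_realE ltcR => xin.
  by exists (xi n); split=> //; apply/norm_eq1.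
Unshelve. all: by end_near. Qed.
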